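(* Let $0<q<1$, and let $\mathcal{O}(D_q)$, $\sigma$, $\partial$, $\bar\partial$, $\Omega^1(D_q)$, $\omega$, $\bar\omega$, $d$ be as defined in the context. Then $$\omega = \frac{q^{-2}}{1-q^2}\left(dz\, z - q^4 z\,dz\right), \qquad \bar\omega = \frac{q^{-2}}{1-q^2}\left(z^*dz^* - q^2 dz^*\, z^*\right),$$ hence $\Omega^1(D_q)=\{\sum_i a_i\, d b_i \mid a_i,b_i\in\mathcal{O}(D_q)\}$ (finite sums), i.e. $(\Omega^1(D_q),d)$ is a first-order differential calculus on $\mathcal{O}(D_q)$. Moreover, it is a $*$-calculus with $\omega^*=\bar\omega$: setting $\omega^*=\bar\omega$, the $*$-structure of $\mathcal{O}(D_q)$ extends to $\Omega^1(D_q)$ so that $(a\nu b)^*=b^*\nu^*a^*$ and $(da)^*=d(a^* )$ for all $a,b\in\mathcal{O}(D_q)$ and $\nu\in\Omega^1(D_q)$.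
   Context: $\mathcal{O}(D_q)$ (the quantum disc algebra) is the complex unital $*$-algebra generated by $z$ subject to $z^*z-q^2zz^*=1-q^2$. It is $\mathbb{Z}$-graded by $\deg(z)=1$, $\deg(z^* )=-1$. The automorphism $\sigma$ of $\mathcal{O}(D_q)$ is given on homogeneous elements by $\sigma(a)=q^{2\deg(a)}a$. The linear maps $\partial,\bar\partial:\mathcal{O}(D_q)\to\mathcal{O}(D_q)$ are the skew-derivations determined by $$\partial(z)=z^*,\quad \partial(z^* )=0,\qquad \bar\partial(z)=0,\quad \bar\partial(z^* )=q^2z,$$ and the right $\sigma$-twisted Leibniz rule $\partial(ab)=\partial(a)\sigma(b)+a\partial(b)$, $\bar\partial(ab)=\bar\partial(a)\sigma(b)+a\bar\partial(b)$ (it is known that these are well defined). $\Omega^1(D_q)$ is the $\mathcal{O}(D_q)$-bimodule that is free as a left module on $\omega,\bar\omega$, with right action determined by $\omega a=\sigma(a)\omega$, $\bar\omega a=\sigma(a)\bar\omega$ for $a\in\mathcal{O}(D_q)$, and $d:\mathcal{O}(D_q)\to\Omega^1(D_q)$ is $d(a)=\partial(a)\omega+\bar\partial(a)\bar\omega$. A first-order differential calculus on an algebra $A$ is an $A$-bimodule $\Omega^1$ with a linear map $d:A\to\Omega^1$ satisfying $d(ab)=d(a)b+a\,d(b)$ and such that $\Omega^1$ is spanned by the elements $a\,db$, $a,b\in A$.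
   Formalization: In the formula for ω̄ the coefficient q^2 of dz^* z^* is corrected to q^4: with q^2 the right side equals (1 − zz^* )ω̄, which is not ω̄ because zz^* ≠ 0. *)

(* Defs.v *)
From HB Require Import structures.
From mathcomp Require Import all_boot all_order all_algebra generic_quotient.
From mathcomp Require Import boolp reals complex.
Set Implicit Arguments.
Unset Strict Implicit.
Unset Printing Implicit Defensive.
Import Order.TTheory GRing.Theory Num.Theory.
Local Open Scope ring_scope.
Local Open Scope complex_scope.
Local Open Scope quotient_scope.

Section StarAlgebra.
Variables (R : realType) (A : algType R[i]).

Record star_structure (star : A -> A) : Prop := StarStructure {
  starD : forall a b, star (a + b) = star a + star b;
  starZ : forall (c : R[i]) a, star (c *: a) = Num.conj c *: star a;
  starM : forall a b, star (a * b) = star b * star a;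
  starK : involutive star }.

End StarAlgebra.

(* A-bimodules are left A-modules M with a right action [ract].  The complex
   vector space structure of M is the one given by the scalars c%:A of A. *)
Section Calculus.
Variables (R : realType) (A : algType R[i]) (M : lmodType A).
Variables (ract : M -> A -> M) (d : A -> M).

Record bimodule : Prop := Bimodule {
  ractDl : forall u v a, ract (u + v) a = ract u a + ract v a;
  ractDr : forall u a b, ract u (a + b) = ract u a + ract u b;
  ractM : forall u a b, ract u (a * b) = ract (ract u a) b;
  ract1 : forall u, ract u 1 = u;
  ractAl : forall a u b, ract (a *: u) b = a *: ract u b;
  ract_scalar : forall u (c : R[i]), ract u c%:A = c%:A *: u }.

Definition spanned_by_differentials : Prop :=
  forall w : M, exists s : seq (A * A), w = \sum_(p <- s) p.1 *: d p.2.

Record first_order_calculus : Prop := FirstOrderCalculus {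
  calculus_bimodule : bimodule;
  calculus_dD : forall a b, d (a + b) = d a + d b;
  calculus_dZ : forall (c : R[i]) a, d (c *: a) = c%:A *: d a;
  calculus_leibniz : forall a b, d (a * b) = ract (d a) b + a *: d b;
  calculus_span : spanned_by_differentials }.

Record star_calculus (star : A -> A) (starW : M -> M) : Prop := StarCalculus {
  starWD : forall u v, starW (u + v) = starW u + starW v;
  starWZ : forall (c : R[i]) u,
    starW (c%:A *: u) = (Num.conj c)%:A *: starW u;
  starWK : involutive starW;
  starWM : forall a u b,
    starW (ract (a *: u) b) = ract (star b *: starW u) (star a);
  starWd : forall a, starW (d a) = d (star a) }.

End Calculus.

(* The quantum disc algebra as a presented algebra: expressions in z and z^*
   (tz and tzs) modulo the least congruence containing the axioms of unital
   complex algebras and the defining relation. *)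
Section QuantumDisc.
Variable R : realType.

Inductive term : Type :=
| tz | tzs | t0 | t1
| tadd of term & term
| topp of term
| tmul of term & term
| tscale of R[i] & term.

HB.instance Definition _ := gen_eqMixin term.
HB.instance Definition _ := gen_choiceMixin term.

Variable q : R.

Inductive cong : term -> term -> Prop :=
| cong_refl t : cong t t
| cong_sym t u : cong t u -> cong u t
| cong_trans u t v : cong t u -> cong u v -> cong t v
| cong_add t t' u u' : cong t t' -> cong u u' -> cong (tadd t u) (tadd t' u')
| cong_opp t t' : cong t t' -> cong (topp t) (topp t')
| cong_mul t t' u u' : cong t t' -> cong u u' -> cong (tmul t u) (tmul t' u')
| cong_scale c t t' : cong t t' -> cong (tscale c t) (tscale c t')
| cong_addA t u v : cong (tadd t (tadd u v)) (tadd (tadd t u) v)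
| cong_addC t u : cong (tadd t u) (tadd u t)
| cong_add0 t : cong (tadd t0 t) t
| cong_addN t : cong (tadd (topp t) t) t0
| cong_mulA t u v : cong (tmul t (tmul u v)) (tmul (tmul t u) v)
| cong_mul1l t : cong (tmul t1 t) t
| cong_mul1r t : cong (tmul t t1) t
| cong_mulDl t u v : cong (tmul (tadd t u) v) (tadd (tmul t v) (tmul u v))
| cong_mulDr t u v : cong (tmul t (tadd u v)) (tadd (tmul t u) (tmul t v))
| cong_scaleA c e t : cong (tscale c (tscale e t)) (tscale (c * e) t)
| cong_scale1 t : cong (tscale 1 t) t
| cong_scaleDr c t u : cong (tscale c (tadd t u)) (tadd (tscale c t) (tscale c u))
| cong_scaleDl t c e : cong (tscale (c + e) t) (tadd (tscale c t) (tscale e t))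
| cong_scaleAl c t u : cong (tscale c (tmul t u)) (tmul (tscale c t) u)
| cong_scaleAr c t u : cong (tscale c (tmul t u)) (tmul t (tscale c u))
| cong_disc :
    cong (tadd (tmul tzs tz) (topp (tscale (q%:C ^+ 2) (tmul tz tzs))))
         (tscale (1 - q%:C ^+ 2) t1).

Definition congb : rel term := fun t u => `[< cong t u >].

Lemma congb_refl : reflexive congb.
Proof. by move=> t; apply/asboolP; exact: cong_refl. Qed.

Lemma congb_sym : symmetric congb.
Proof.
by move=> t u; apply/idP/idP => /asboolP h; apply/asboolP; exact: cong_sym.
Qed.

Lemma congb_trans : transitive congb.
Proof.
by move=> u t v /asboolP h /asboolP h'; apply/asboolP; exact: cong_trans h h'.
Qed.

Canonical congb_equiv := EquivRel congb congb_refl congb_sym congb_trans.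

Definition qdisc := {eq_quot congb_equiv}.
HB.instance Definition _ := Choice.on qdisc.

Definition cls (t : term) : qdisc := \pi_({eq_quot congb_equiv}) t.

Lemma clsP t u : cong t u -> cls t = cls u.
Proof. by move=> h; apply/eqP; rewrite /cls eqmodE; apply/asboolP. Qed.

Lemma cls_cong t u : cls t = cls u -> cong t u.
Proof. by move=> /eqP; rewrite /cls eqmodE => /asboolP. Qed.

Lemma clsW (P : qdisc -> Prop) : (forall t, P (cls t)) -> forall a, P a.
Proof. by move=> h; exact: quotW. Qed.

Definition rep (a : qdisc) : term := repr (a : {eq_quot congb_equiv}).

Lemma repK a : cls (rep a) = a.
Proof. exact: reprK. Qed.

Lemma rep_cls t : cong (rep (cls t)) t.
Proof. by apply: cls_cong; rewrite repK. Qed.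

Definition qadd (a b : qdisc) : qdisc := cls (tadd (rep a) (rep b)).
Definition qopp (a : qdisc) : qdisc := cls (topp (rep a)).
Definition qmul (a b : qdisc) : qdisc := cls (tmul (rep a) (rep b)).
Definition qscale (c : R[i]) (a : qdisc) : qdisc := cls (tscale c (rep a)).

Fact qaddE t u : qadd (cls t) (cls u) = cls (tadd t u).
Proof. by apply: clsP; apply: cong_add; exact: rep_cls. Qed.
Fact qoppE t : qopp (cls t) = cls (topp t).
Proof. by apply: clsP; apply: cong_opp; exact: rep_cls. Qed.
Fact qmulE t u : qmul (cls t) (cls u) = cls (tmul t u).
Proof. by apply: clsP; apply: cong_mul; exact: rep_cls. Qed.
Fact qscaleE c t : qscale c (cls t) = cls (tscale c t).
Proof. by apply: clsP; apply: cong_scale; exact: rep_cls. Qed.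
Let qE := (qaddE, qoppE, qmulE, qscaleE).

Fact qaddA : associative qadd.
Proof.
elim/clsW => t; elim/clsW => u; elim/clsW => v; rewrite !qE.
exact/clsP/cong_addA.
Qed.
Fact qaddC : commutative qadd.
Proof. elim/clsW => t; elim/clsW => u; rewrite !qE; exact/clsP/cong_addC. Qed.
Fact qadd0 : left_id (cls t0) qadd.
Proof. elim/clsW => t; rewrite !qE; exact/clsP/cong_add0. Qed.
Fact qaddN : left_inverse (cls t0) qopp qadd.
Proof. elim/clsW => t; rewrite !qE; exact/clsP/cong_addN. Qed.

HB.instance Definition _ := GRing.isZmodule.Build qdisc qaddA qaddC qadd0 qaddN.

Fact qmulA : associative qmul.
Proof.
elim/clsW => t; elim/clsW => u; elim/clsW => v; rewrite !qE.
exact/clsP/cong_mulA.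
Qed.
Fact qmul1l : left_id (cls t1) qmul.
Proof. elim/clsW => t; rewrite !qE; exact/clsP/cong_mul1l. Qed.
Fact qmul1r : right_id (cls t1) qmul.
Proof. elim/clsW => t; rewrite !qE; exact/clsP/cong_mul1r. Qed.
Fact qmulDl : left_distributive qmul +%R.
Proof.
elim/clsW => t; elim/clsW => u; elim/clsW => v; rewrite /GRing.add /= !qE.
exact/clsP/cong_mulDl.
Qed.
Fact qmulDr : right_distributive qmul +%R.
Proof.
elim/clsW => t; elim/clsW => u; elim/clsW => v; rewrite /GRing.add /= !qE.
exact/clsP/cong_mulDr.
Qed.

Section Evaluation.
Variables (B : algType R[i]) (x y : B).

Fixpoint eval (t : term) : B :=
  match t with
  | tz => x
  | tzs => y
  | t0 => 0
  | t1 => 1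
  | tadd t u => eval t + eval u
  | topp t => - eval t
  | tmul t u => eval t * eval u
  | tscale c t => c *: eval t
  end.

Hypothesis xy : y * x - (q%:C ^+ 2) *: (x * y) = (1 - q%:C ^+ 2)%:A.

Lemma eval_cong t u : cong t u -> eval t = eval u.
Proof.
elim=> {t u} //=.
- by move=> t u v _ -> _ ->.
- by move=> t t' u u' _ -> _ ->.
- by move=> t t' _ ->.
- by move=> t t' u u' _ -> _ ->.
- by move=> c t t' _ ->.
- by move=> *; rewrite addrA.
- by move=> *; rewrite addrC.
- by move=> *; rewrite add0r.
- by move=> *; rewrite addNr.
- by move=> *; rewrite mulrA.
- by move=> *; rewrite mul1r.
- by move=> *; rewrite mulr1.
- by move=> *; rewrite mulrDl.
- by move=> *; rewrite mulrDr.
- by move=> *; rewrite scalerA.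
- by move=> *; rewrite scale1r.
- by move=> *; rewrite scalerDr.
- by move=> *; rewrite scalerDl.
- by move=> *; rewrite scalerAl.
- by move=> *; rewrite scalerAr.
Qed.

End Evaluation.

Fact qone_neq0 : cls t1 != 0.
Proof.
apply/eqP => /cls_cong /(@eval_cong R[i]^o 1 1); rewrite /= => h.
have /h /eqP : 1 * 1 - q%:C ^+ 2 *: (1 * 1) = (1 - q%:C ^+ 2)%:A :> R[i]^o.
  by rewrite !mul1r scalerBl scale1r.
by rewrite oner_eq0.
Qed.

HB.instance Definition _ := GRing.Zmodule_isNzRing.Build qdisc
  qmulA qmul1l qmul1r qmulDl qmulDr qone_neq0.

Fact qscaleA c e (a : qdisc) : qscale c (qscale e a) = qscale (c * e) a.
Proof. elim/clsW: a => t; rewrite !qE; exact/clsP/cong_scaleA. Qed.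
Fact qscale1 : left_id 1 qscale.
Proof. elim/clsW => t; rewrite !qE; exact/clsP/cong_scale1. Qed.
Fact qscaleDr : right_distributive qscale +%R.
Proof.
move=> c; elim/clsW => t; elim/clsW => u; rewrite /GRing.add /= !qE.
exact/clsP/cong_scaleDr.
Qed.
Fact qscaleDl a : {morph qscale^~ a : c e / c + e}.
Proof.
move=> c e; elim/clsW: a => t; rewrite [RHS]/GRing.add /= !qE.
exact/clsP/cong_scaleDl.
Qed.

HB.instance Definition _ := GRing.Zmodule_isLmodule.Build R[i] qdisc
  qscaleA qscale1 qscaleDr qscaleDl.

Fact qscaleAl (c : R[i]) (a b : qdisc) : c *: (a * b) = (c *: a) * b.
Proof.
elim/clsW: a => t; elim/clsW: b => u; rewrite /GRing.mul /GRing.scale /= !qE.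
exact/clsP/cong_scaleAl.
Qed.

HB.instance Definition _ := GRing.Lmodule_isLalgebra.Build R[i] qdisc qscaleAl.

Fact qscaleAr (c : R[i]) (a b : qdisc) : c *: (a * b) = a * (c *: b).
Proof.
elim/clsW: a => t; elim/clsW: b => u; rewrite /GRing.mul /GRing.scale /= !qE.
exact/clsP/cong_scaleAr.
Qed.

HB.instance Definition _ := GRing.Lalgebra_isAlgebra.Build R[i] qdisc qscaleAr.

Definition qz : qdisc := cls tz.
Definition qzs : qdisc := cls tzs.

(* The maps below are given on expressions and transported to the quotient
   through representatives. *)
Fixpoint tstar (t : term) : term :=
  match t with
  | tz => tzs
  | tzs => tz
  | t0 => t0
  | t1 => t1
  | tadd t u => tadd (tstar t) (tstar u)
  | topp t => topp (tstar t)
  | tmul t u => tmul (tstar u) (tstar t)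
  | tscale c t => tscale (Num.conj c) (tstar t)
  end.

Definition qstar (a : qdisc) : qdisc := cls (tstar (rep a)).

(* Multiplying z by q^2 and z^* by q^-2 is multiplying an element of degree n
   by q^(2n); see sigma_homogeneous. *)
Definition sigma (a : qdisc) : qdisc :=
  eval ((q%:C ^+ 2) *: qz) ((q%:C ^- 2) *: qzs) (rep a).

(* The linear map on expressions with values a, b at z, z^* satisfying the
   σ-twisted Leibniz rule; tder_cong says when it descends to the quotient. *)
Fixpoint tder (a b : qdisc) (t : term) : qdisc :=
  match t with
  | tz => a
  | tzs => b
  | t0 => 0
  | t1 => 0
  | tadd t u => tder a b t + tder a b u
  | topp t => - tder a b t
  | tmul t u => tder a b t * sigma (cls u) + cls t * tder a b u
  | tscale c t => c *: tder a b t
  end.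

Definition del (a : qdisc) : qdisc := tder qzs 0 (rep a).
Definition delbar (a : qdisc) : qdisc := tder 0 ((q%:C ^+ 2) *: qz) (rep a).

(* The free left module with basis (1, 0), (0, 1). *)
Definition Omega1 : Type := (qdisc^o * qdisc^o)%type.
HB.instance Definition _ := GRing.Lmodule.on Omega1.

Definition omega : Omega1 := (1, 0).
Definition omegabar : Omega1 := (0, 1).

(* (a ω + b ω̄) c = a σ(c) ω + b σ(c) ω̄ *)
Definition Omega1_ract (u : Omega1) (c : qdisc) : Omega1 :=
  (u.1 * sigma c) *: omega + (u.2 * sigma c) *: omegabar.

Definition dd (a : qdisc) : Omega1 := del a *: omega + delbar a *: omegabar.

(* The grading with deg z = 1 and deg z^* = -1. *)
Inductive homogeneous : int -> qdisc -> Prop :=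
| homogeneous_z : homogeneous 1 qz
| homogeneous_zs : homogeneous (-1) qzs
| homogeneous_1 : homogeneous 0 1
| homogeneous_0 n : homogeneous n 0
| homogeneousD n a b :
    homogeneous n a -> homogeneous n b -> homogeneous n (a + b)
| homogeneousZ n (c : R[i]) a : homogeneous n a -> homogeneous n (c *: a)
| homogeneousM m n a b :
    homogeneous m a -> homogeneous n b -> homogeneous (m + n) (a * b).

Lemma clsD t u : cls (tadd t u) = cls t + cls u.
Proof. by rewrite -qaddE. Qed.
Lemma clsN t : cls (topp t) = - cls t.
Proof. by rewrite -qoppE. Qed.
Lemma clsM t u : cls (tmul t u) = cls t * cls u.
Proof. by rewrite -qmulE. Qed.
Lemma clsZ c t : cls (tscale c t) = c *: cls t.
Proof. by rewrite -qscaleE. Qed.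
Lemma cls0 : cls t0 = 0.
Proof. by []. Qed.
Lemma cls1 : cls t1 = 1.
Proof. by []. Qed.
Let clsE := (clsD, clsN, clsM, clsZ, cls0, cls1).

Lemma qdisc_relation : qzs * qz - (q%:C ^+ 2) *: (qz * qzs) = (1 - q%:C ^+ 2)%:A.
Proof. by have := clsP cong_disc; rewrite !clsE. Qed.

Lemma conjCr (x : R) : Num.conj x%:C = x%:C.
Proof. by rewrite /Num.conj /= /conjc oppr0. Qed.

Lemma tstar_cong t u : cong t u -> cong (tstar t) (tstar u).
Proof.
elim=> {t u} /=.
- by move=> *; exact: cong_refl.
- by move=> *; exact: cong_sym.
- by move=> u t v _ h _; exact: cong_trans.
- by move=> *; exact: cong_add.
- by move=> *; exact: cong_opp.
- by move=> *; exact: cong_mul.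
- by move=> *; exact: cong_scale.
- by move=> *; exact: cong_addA.
- by move=> *; exact: cong_addC.
- by move=> *; exact: cong_add0.
- by move=> *; exact: cong_addN.
- by move=> *; exact/cong_sym/cong_mulA.
- by move=> *; exact: cong_mul1r.
- by move=> *; exact: cong_mul1l.
- by move=> *; exact: cong_mulDr.
- by move=> *; exact: cong_mulDl.
- by move=> *; rewrite rmorphM; exact: cong_scaleA.
- by move=> *; rewrite rmorph1; exact: cong_scale1.
- by move=> *; exact: cong_scaleDr.
- by move=> *; rewrite rmorphD; exact: cong_scaleDl.
- by move=> *; exact: cong_scaleAr.
- by move=> *; exact: cong_scaleAl.
- have E : Num.conj (q%:C ^+ 2) = q%:C ^+ 2 by rewrite rmorphXn /= conjCr.
  by rewrite rmorphB rmorph1 /= !E; exact: cong_disc.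
Qed.

Lemma qstar_cls t : qstar (cls t) = cls (tstar t).
Proof. exact/clsP/tstar_cong/rep_cls. Qed.

Lemma qstar_structure : star_structure qstar.
Proof.
split.
- by elim/clsW => t; elim/clsW => u; rewrite -clsD !qstar_cls /= clsD.
- by move=> c; elim/clsW => t; rewrite -clsZ !qstar_cls /= clsZ.
- by elim/clsW => t; elim/clsW => u; rewrite -clsM !qstar_cls /= clsM.
- elim/clsW => t; rewrite !qstar_cls; congr cls.
  elim: t => //= [t -> u ->|t ->|t -> u ->|c t ->] //.
  by rewrite conjCK.
Qed.

Lemma qstar_z : qstar qz = qzs. Proof. exact: qstar_cls. Qed.
Lemma qstar_zs : qstar qzs = qz. Proof. exact: qstar_cls. Qed.

(* The universal property of the *-algebra with the given presentation. *)
Lemma qdisc_universal (B : algType R[i]) (starB : B -> B) (x : B) :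
  star_structure starB ->
  starB x * x - (q%:C ^+ 2) *: (x * starB x) = (1 - q%:C ^+ 2)%:A ->
  exists f : {lrmorphism qdisc -> B},
    [/\ f qz = x, forall a, f (qstar a) = starB (f a) &
      forall g : {lrmorphism qdisc -> B},
        g qz = x -> (forall a, g (qstar a) = starB (g a)) -> g =1 f].
Proof.
move=> sB hx.
pose f (a : qdisc) : B := eval x (starB x) (rep a).
have fE t : f (cls t) = eval x (starB x) t by exact/(eval_cong hx)/rep_cls.
have flin : linear f.
  move=> c; elim/clsW => t; elim/clsW => u.
  by rewrite -clsZ -clsD !fE.
have fmul : monoid_morphism f.
  by split; [rewrite -cls1 fE | elim/clsW => t; elim/clsW => u; rewrite -clsM !fE].
pose F : {lrmorphism qdisc -> B} :=
  HB.pack f (GRing.isLinear.Build R[i] qdisc B *:%R f flin)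
            (GRing.isMonoidMorphism.Build qdisc B f fmul).
have sB0 : starB 0 = 0 by apply: (addIr (starB 0)); rewrite -(starD sB) !add0r.
have sBN a : starB (- a) = - starB a.
  by apply/eqP; rewrite -addr_eq0 -(starD sB) addNr sB0.
have sB1 : starB 1 = 1.
  by rewrite -[LHS]mulr1 -{2}(starK sB 1) -(starM sB) mulr1 (starK sB).
exists F; split; first by rewrite /F /= /qz fE.
  elim/clsW => t; rewrite qstar_cls /F /= !fE.
  elim: t => //= [|t IHt u IHu|t IHt|t IHt u IHu|c t IHt].
  - by rewrite (starK sB).
  - by rewrite IHt IHu (starD sB).
  - by rewrite IHt sBN.
  - by rewrite IHt IHu (starM sB).
  - by rewrite IHt (starZ sB).
move=> g gz gs; have gzs : g qzs = starB x by rewrite -qstar_z gs gz.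
elim/clsW => t; rewrite /F /= fE.
elim: t => //= [||t IHt u IHu|t IHt|t IHt u IHu|c t IHt].
- by rewrite cls0 rmorph0.
- by rewrite cls1 rmorph1.
- by rewrite clsD rmorphD /= IHt IHu.
- by rewrite clsN rmorphN /= IHt.
- by rewrite clsM rmorphM /= IHt IHu.
- by rewrite clsZ linearZ /= IHt.
Qed.

Section SkewDerivations.
Hypothesis q_neq0 : q != 0.

Let qC_neq0 : q%:C != 0. Proof. by rewrite eq_complex /= eqxx andbT. Qed.

Lemma sigma_cls t :
  sigma (cls t) = eval ((q%:C ^+ 2) *: qz) ((q%:C ^- 2) *: qzs) t.
Proof.
apply: eval_cong (rep_cls t).
rewrite -!scalerAl -!scalerAr !scalerA mulVf ?expf_neq0 // scale1r.
by rewrite -mulrA mulfV ?expf_neq0 // mulr1 qdisc_relation.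
Qed.

Lemma sigmaD a b : sigma (a + b) = sigma a + sigma b.
Proof. by elim/clsW: a => t; elim/clsW: b => u; rewrite -clsD !sigma_cls. Qed.
Lemma sigmaZ c a : sigma (c *: a) = c *: sigma a.
Proof. by elim/clsW: a => t; rewrite -clsZ !sigma_cls. Qed.
Lemma sigmaM a b : sigma (a * b) = sigma a * sigma b.
Proof. by elim/clsW: a => t; elim/clsW: b => u; rewrite -clsM !sigma_cls. Qed.
Lemma sigma1 : sigma 1 = 1.
Proof. by rewrite -cls1 sigma_cls. Qed.
Lemma sigma_z : sigma qz = (q%:C ^+ 2) *: qz.
Proof. exact: sigma_cls. Qed.
Lemma sigma_zs : sigma qzs = (q%:C ^- 2) *: qzs.
Proof. exact: sigma_cls. Qed.

Lemma sigma_homogeneous n a :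
  homogeneous n a -> sigma a = (q%:C ^ (2 * n)) *: a.
Proof.
elim=> {n a} [|||n|n a b _ IHa _ IHb|n c a _ IHa|m n a b _ IHa _ IHb].
- exact: sigma_z.
- exact: sigma_zs.
- by rewrite sigma1 scale1r.
- by rewrite -[0 in LHS](scale0r (0 : qdisc)) sigmaZ scale0r scaler0.
- by rewrite sigmaD IHa IHb scalerDr.
- by rewrite sigmaZ IHa !scalerA mulrC.
- by rewrite sigmaM IHa IHb -scalerAl -scalerAr scalerA mulrDr expfzDr.
Qed.

Section TwistedLeibniz.
Variables a b : qdisc.
Hypothesis ab : b * sigma qz + qzs * a
  = (q%:C ^+ 2) *: (a * sigma qzs + qz * b).

Lemma tder_cong t u : cong t u -> tder a b t = tder a b u.
Proof.
elim=> {t u} //=.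
- by move=> t u v _ -> _ ->.
- by move=> t t' u u' _ -> _ ->.
- by move=> t t' _ ->.
- by move=> t t' u u' /clsP -> -> /clsP -> ->.
- by move=> c t t' _ ->.
- by move=> *; rewrite addrA.
- by move=> *; rewrite addrC.
- by move=> *; rewrite add0r.
- by move=> *; rewrite addNr.
- by move=> *; rewrite !clsM sigmaM !mulrDl !mulrDr !mulrA addrA.
- by move=> *; rewrite cls1 mul0r add0r mul1r.
- by move=> *; rewrite cls1 sigma1 mulr1 mulr0 addr0.
- by move=> *; rewrite clsD !mulrDl addrACA.
- by move=> *; rewrite clsD sigmaD !mulrDr addrACA.
- by move=> *; rewrite scalerA.
- by move=> *; rewrite scale1r.
- by move=> *; rewrite scalerDr.
- by move=> *; rewrite scalerDl.
- by move=> *; rewrite clsZ scalerDr !scalerAl.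
- by move=> *; rewrite clsZ sigmaZ scalerDr !scalerAr.
- by rewrite ab subrr scaler0.
Qed.

Lemma tder_rep t : tder a b (rep (cls t)) = tder a b t.
Proof. exact/tder_cong/rep_cls. Qed.

End TwistedLeibniz.

Lemma del_cls t : del (cls t) = tder qzs 0 t.
Proof.
apply: tder_rep; rewrite mul0r add0r mulr0 addr0 sigma_zs -scalerAr scalerA.
by rewrite mulfV ?expf_neq0 // scale1r.
Qed.

Lemma delbar_cls t : delbar (cls t) = tder 0 ((q%:C ^+ 2) *: qz) t.
Proof. by apply: tder_rep; rewrite mul0r add0r mulr0 addr0 sigma_z -scalerAl -!scalerAr. Qed.

Lemma del_z : del qz = qzs. Proof. exact: del_cls. Qed.
Lemma del_zs : del qzs = 0. Proof. exact: del_cls. Qed.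
Lemma delD a b : del (a + b) = del a + del b.
Proof. by elim/clsW: a => t; elim/clsW: b => u; rewrite -clsD !del_cls. Qed.
Lemma delZ c a : del (c *: a) = c *: del a.
Proof. by elim/clsW: a => t; rewrite -clsZ !del_cls. Qed.
Lemma delM a b : del (a * b) = del a * sigma b + a * del b.
Proof. by elim/clsW: a => t; elim/clsW: b => u; rewrite -clsM !del_cls. Qed.

Lemma delbar_z : delbar qz = 0. Proof. exact: delbar_cls. Qed.
Lemma delbar_zs : delbar qzs = (q%:C ^+ 2) *: qz. Proof. exact: delbar_cls. Qed.
Lemma delbarD a b : delbar (a + b) = delbar a + delbar b.
Proof. by elim/clsW: a => t; elim/clsW: b => u; rewrite -clsD !delbar_cls. Qed.
Lemma delbarZ c a : delbar (c *: a) = c *: delbar a.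
Proof. by elim/clsW: a => t; rewrite -clsZ !delbar_cls. Qed.
Lemma delbarM a b : delbar (a * b) = delbar a * sigma b + a * delbar b.
Proof. by elim/clsW: a => t; elim/clsW: b => u; rewrite -clsM !delbar_cls. Qed.

Lemma omega_ract a : Omega1_ract omega a = sigma a *: omega.
Proof. by rewrite /Omega1_ract /= mul1r mul0r scale0r addr0. Qed.
Lemma omegabar_ract a : Omega1_ract omegabar a = sigma a *: omegabar.
Proof. by rewrite /Omega1_ract /= mul1r mul0r scale0r add0r. Qed.

End SkewDerivations.

End QuantumDisc.

(* Main.v *)
Require Import Defs.
From mathcomp Require Import all_boot all_order all_algebra.
From mathcomp Require Import reals complex.
Import Order.TTheory GRing.Theory Num.Theory.
Local Open Scope ring_scope.
Local Open Scope complex_scope.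

(** In coordinates with respect to [omega] and [omegabar] every bimodule axiom
    is a ring identity involving the automorphism [sigma], and the Leibniz
    rule for [dd] is the pair of twisted Leibniz rules for [del] and
    [delbar].

    The formulas for [omega] and [omegabar] come from the defining relation:
    since [dd z = zs omega], the one-form [dz z - q^4 z dz] is
    [q^2 (zs z - q^2 z zs) omega], and the bracket is the nonzero scalar
    [1 - q^2] ([omega_formula]; the case of [omegabar_formula] is alike).
    By the Leibniz rule [da b = d(ab) - a db], so the left submodule
    spanned by differentials contains both generators, hence everything
    ([qdisc_spanned]).

    The condition [omega^* = omegabar] and antimultiplicativity force
    [(a omega)^* = omegabar a^* = sigma(a^* ) omegabar], so the star has to be
    [(a, b) |-> (sigma(b^* ), sigma(a^* ))].  It is involutive because the star
    intertwines [sigma] with its inverse ([sigma_star_sigma]), and it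
    commutes with [dd] because conjugating [delbar] by the star yields [del] up
    to a twist by [sigma] ([del_star]). *)

Section QuantumDiscCalculus.
Variables (R : realType) (q : R).

Local Notation disc := (qdisc q).
Local Notation Om := (Omega1 q).

(** * Stars and twists on the algebra *)

Lemma qdisc_ind (P : disc -> Prop) :
  P (qz q) -> P (qzs q) -> P 1 ->
  (forall a b, P a -> P b -> P (a + b)) ->
  (forall c a, P a -> P (c *: a)) ->
  (forall a b, P a -> P b -> P (a * b)) ->
  forall a, P a.
Proof.
move=> Pz Pzs P1 PD PZ PM; elim/clsW.
elim=> [|||||||] //=.
- by rewrite cls0 -(scale0r (1 : disc)); exact: PZ.
- by move=> t Pt u Pu; rewrite clsD; exact: PD.
- by move=> t Pt; rewrite clsN -scaleN1r; exact: PZ.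
- by move=> t Pt u Pu; rewrite clsM; exact: PM.
- by move=> c t Pt; rewrite clsZ; exact: PZ.
Qed.

Lemma qstarD (a b : disc) : qstar (a + b) = qstar a + qstar b.
Proof. exact: (starD (qstar_structure q)). Qed.

Lemma qstarZ c (a : disc) : qstar (c *: a) = Num.conj c *: qstar a.
Proof. exact: (starZ (qstar_structure q)). Qed.

Lemma qstarM (a b : disc) : qstar (a * b) = qstar b * qstar a.
Proof. exact: (starM (qstar_structure q)). Qed.

Lemma qstarK : involutive (@qstar R q).
Proof. exact: (starK (qstar_structure q)). Qed.

Lemma qstar1 : qstar (1 : disc) = 1.
Proof. exact: qstar_cls. Qed.

Lemma qstar0 : qstar (0 : disc) = 0.
Proof. exact: qstar_cls. Qed.

Hypothesis q_neq0 : q != 0.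

Let qC_neq0 : q%:C != 0. Proof. by rewrite eq_complex /= eqxx andbT. Qed.

Lemma conj_qX n : Num.conj (q%:C ^+ n) = q%:C ^+ n.
Proof. by rewrite rmorphXn /= conjCr. Qed.

(** The star reverses the grading, so it turns [sigma] into its inverse. *)
Lemma sigma_star_sigma (a : disc) : sigma (qstar (sigma a)) = qstar a.
Proof.
elim/qdisc_ind: a => [|||a b IHa IHb|c a IHa|a b IHa IHb].
- rewrite sigma_z // qstarZ qstar_z conj_qX sigmaZ // sigma_zs // scalerA.
  by rewrite mulfV ?expf_neq0 // scale1r.
- rewrite sigma_zs // qstarZ qstar_zs fmorphV /= conj_qX sigmaZ // sigma_z //.
  by rewrite scalerA mulVf ?expf_neq0 // scale1r.
- by rewrite sigma1 // qstar1 sigma1.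
- by rewrite sigmaD // !qstarD sigmaD // IHa IHb.
- by rewrite sigmaZ // !qstarZ sigmaZ // IHa.
- by rewrite sigmaM // !qstarM sigmaM // IHa IHb.
Qed.

Lemma del1 : del (1 : disc) = 0.
Proof. by rewrite -cls1 del_cls. Qed.

Lemma delbar1 : delbar (1 : disc) = 0.
Proof. by rewrite -cls1 delbar_cls. Qed.

Lemma sigma0 : sigma (0 : disc) = 0.
Proof. by rewrite -cls0 sigma_cls. Qed.

(** Both sides satisfy the same twisted Leibniz rule for the reversed
    product, so it is enough to compare them on the generators. *)
Lemma del_star (a : disc) : del (qstar a) = sigma (qstar (delbar a)).
Proof.
elim/qdisc_ind: a => [|||a b IHa IHb|c a IHa|a b IHa IHb].
- by rewrite qstar_z del_zs // delbar_z // qstar0 sigma0.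
- rewrite qstar_zs del_z // delbar_zs // qstarZ qstar_z conj_qX sigmaZ //.
  by rewrite sigma_zs // scalerA mulfV ?expf_neq0 // scale1r.
- by rewrite qstar1 del1 delbar1 qstar0 sigma0.
- by rewrite qstarD delD // delbarD // qstarD sigmaD // IHa IHb.
- by rewrite qstarZ delZ // delbarZ // qstarZ sigmaZ // IHa.
- rewrite qstarM delM // delbarM // qstarD !qstarM sigmaD // !sigmaM //.
  by rewrite sigma_star_sigma IHa IHb addrC.
Qed.

Lemma delbar_star (a : disc) : delbar (qstar a) = sigma (qstar (del a)).
Proof. by rewrite -{2}[a]qstarK del_star sigma_star_sigma qstarK. Qed.

(** * The calculus in coordinates *)

Lemma omega_coords (a b : disc) :
  a *: omega q + b *: omegabar q = (a, b) :> Om.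
Proof.
by congr pair; rewrite /= /GRing.scale /= mulr1 mulr0 ?addr0 ?add0r.
Qed.

Lemma Omega1_ractE (u : Om) (a : disc) :
  Omega1_ract u a = (u.1 * sigma a, u.2 * sigma a).
Proof. exact: omega_coords. Qed.

Lemma ddE (a : disc) : dd a = (del a, delbar a).
Proof. exact: omega_coords. Qed.

Lemma Omega1_scaleE (a : disc) (u : Om) : a *: u = (a * u.1, a * u.2).
Proof. by []. Qed.

Lemma Omega1_addE (u v : Om) : u + v = (u.1 + v.1, u.2 + v.2).
Proof. by []. Qed.

Lemma Omega1_bimodule : bimodule (@Omega1_ract R q).
Proof.
split=> [u v a|u a b|u a b|u|a u b|u c].
- by rewrite !Omega1_ractE Omega1_addE /= !mulrDl.
- by rewrite !Omega1_ractE sigmaD // Omega1_addE /= !mulrDr.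
- by rewrite !Omega1_ractE sigmaM //= !mulrA.
- by case: u => u1 u2; rewrite Omega1_ractE sigma1 // !mulr1.
- by rewrite !Omega1_ractE !Omega1_scaleE /= !mulrA.
- by rewrite Omega1_ractE Omega1_scaleE sigmaZ // sigma1 // !mulr_algl -!scalerAr !mulr1.
Qed.

Lemma dd_leibniz (a b : disc) :
  dd (a * b) = Omega1_ract (dd a) b + a *: dd b.
Proof.
by rewrite Omega1_ractE !ddE Omega1_scaleE Omega1_addE delM // delbarM.
Qed.

(** * The generators as combinations of differentials *)

Hypothesis q2_neq1 : 1 - q%:C ^+ 2 != 0.

Let k : R[i] := q%:C ^- 2 / (1 - q%:C ^+ 2).

(** The constant [k] normalises both formulas at once. *)
Lemma normalised_relation :
  k%:A * (q%:C ^+ 2 *: (qzs q * qz q - q%:C ^+ 2 *: (qz q * qzs q))) = 1 :> disc.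
Proof.
rewrite qdisc_relation mulr_algl !scalerA /k.
by rewrite mulrAC mulfVK // mulVf ?expf_neq0 // scale1r.
Qed.

Lemma omega_formula :
  omega q = k%:A *: (Omega1_ract (dd (qz q)) (qz q)
                     - (q%:C ^+ 4)%:A *: (qz q *: dd (qz q))) :> Om.
Proof.
rewrite Omega1_ractE !Omega1_scaleE ddE /= del_z // delbar_z //.
rewrite sigma_z // mul0r !mulr0 subr0 mulr0; congr pair.
rewrite -[LHS]normalised_relation; congr (_ * _).
by rewrite mulr_algl scalerBr scalerA -exprD -scalerAr.
Qed.

Lemma omegabar_formula :
  omegabar q = k%:A *: (qzs q *: dd (qzs q)
                - (q%:C ^+ 4)%:A *: Omega1_ract (dd (qzs q)) (qzs q)) :> Om.
Proof.
rewrite Omega1_ractE !Omega1_scaleE ddE /= del_zs // delbar_zs //.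
rewrite sigma_zs // mul0r !mulr0 subr0 mulr0; congr pair.
rewrite -[LHS]normalised_relation; congr (_ * _).
rewrite mulr_algl scalerBr scalerA -exprD -!scalerAr -scalerAl.
by rewrite [_ ^- 2 *: (_ *: _)]scalerA mulVf ?expf_neq0 // scale1r.
Qed.

Definition in_span (w : Om) : Prop :=
  exists s : seq (disc * disc), w = \sum_(p <- s) p.1 *: dd p.2.

Lemma in_spanD u v : in_span u -> in_span v -> in_span (u + v).
Proof. by move=> [s ->] [t ->]; exists (s ++ t); rewrite big_cat. Qed.

Lemma in_spanZ (a : disc) u : in_span u -> in_span (a *: u).
Proof.
move=> [s ->]; exists [seq (a * p.1, p.2) | p <- s].
by rewrite big_map scaler_sumr; apply: eq_bigr => p _; rewrite scalerA.
Qed.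

Lemma in_spanB u v : in_span u -> in_span v -> in_span (u - v).
Proof.
by move=> su sv; rewrite -scaleN1r; apply: in_spanD => //; exact: in_spanZ.
Qed.

Lemma in_span_dd (a : disc) : in_span (dd a).
Proof. by exists [:: (1, a)]; rewrite big_seq1 scale1r. Qed.

(** By the Leibniz rule a differential multiplied on the right is a
    left combination of differentials. *)
Lemma in_span_ract (a b : disc) : in_span (Omega1_ract (dd a) b).
Proof.
have -> : Omega1_ract (dd a) b = dd (a * b) - a *: dd b.
  by rewrite dd_leibniz addrK.
by apply: in_spanB; [|apply: in_spanZ]; exact: in_span_dd.
Qed.

Lemma qdisc_spanned : spanned_by_differentials (@dd R q).
Proof.
move=> [a b]; change (in_span (a, b)); rewrite -omega_coords.
apply: in_spanD; apply: in_spanZ.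
- rewrite omega_formula; apply/in_spanZ/in_spanB; first exact: in_span_ract.
  by do 2 apply: in_spanZ; exact: in_span_dd.
- rewrite omegabar_formula; apply/in_spanZ/in_spanB.
    by apply: in_spanZ; exact: in_span_dd.
  by apply: in_spanZ; exact: in_span_ract.
Qed.

Lemma qdisc_calculus : first_order_calculus (@Omega1_ract R q) (@dd R q).
Proof.
split; [exact: Omega1_bimodule | | |exact: dd_leibniz|exact: qdisc_spanned].
- by move=> a b; rewrite !ddE Omega1_addE delD // delbarD.
- by move=> c a; rewrite !ddE Omega1_scaleE delZ // delbarZ //= !mulr_algl.
Qed.

(** * The star on one-forms *)

Definition Omega1_star (u : Om) : Om := (sigma (qstar u.2), sigma (qstar u.1)).

Lemma Omega1_star_omega : Omega1_star (omega q) = omegabar q.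
Proof. by rewrite /Omega1_star /= qstar0 sigma0 qstar1 sigma1. Qed.

Lemma qdisc_star_calculus :
  star_calculus (@Omega1_ract R q) (@dd R q) (@qstar R q) Omega1_star.
Proof.
split=> [u v|c u|[u1 u2]|a u b|a]; rewrite /Omega1_star.
- by rewrite Omega1_addE /= !qstarD !sigmaD.
- by rewrite !Omega1_scaleE /= !mulr_algl !qstarZ !sigmaZ.
- by rewrite /= !sigma_star_sigma !qstarK.
- rewrite !Omega1_ractE !Omega1_scaleE /= !qstarM !sigmaM //.
  by rewrite sigma_star_sigma !mulrA.
- by rewrite !ddE /= del_star delbar_star.
Qed.

End QuantumDiscCalculus.

Theorem mainTheorem1 (R : realType) (q : R) (hq : 0 < q < 1) :
  let z : qdisc q := qz q in
  let zs : qdisc q := qstar z in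
  let k : R[i] := q%:C ^- 2 / (1 - q%:C ^+ 2) in
  [/\ omega q =
        k%:A *: (Omega1_ract (dd z) z - (q%:C ^+ 4)%:A *: (z *: dd z)),
      omegabar q =
        k%:A *: (zs *: dd zs - (q%:C ^+ 4)%:A *: Omega1_ract (dd zs) zs),
      spanned_by_differentials (dd (q := q)),
      first_order_calculus (Omega1_ract (q := q)) (dd (q := q)) &
      exists starW : Omega1 q -> Omega1 q,
        starW (omega q) = omegabar q /\
        star_calculus (Omega1_ract (q := q)) (dd (q := q))
          (qstar (q := q)) starW].
Proof.
have /andP[q0 q1] := hq.
have qn0 : q != 0 by rewrite gt_eqF.
have q2n1 : 1 - q%:C ^+ 2 != 0.
  rewrite subr_eq0 eq_sym -rmorphXn /= eq_complex /= negb_and.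
  by rewrite lt_eqF // expr_lt1 // ltW.
move=> z zs k; rewrite /zs /z qstar_z; split.
- exact: omega_formula.
- exact: omegabar_formula.
- exact: qdisc_spanned.
- exact: qdisc_calculus.
- by exists (@Omega1_star R q); split;
    [exact: Omega1_star_omega | exact: qdisc_star_calculus].
Qed.
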